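(* Let $n\ge 1$. The class of $(\langle\ \rangle;,\mathsf A_1,\dots,\mathsf A_n)$-algebras that are representable by $n$-ary partial functions is a proper quasivariety, and it is finitely axiomatised by the following (quasi)equations (each universally quantified over all element variables occurring in it): (1) $\langle \boldsymbol a; b_1,\dots,\boldsymbol a; b_n\rangle ; c = \boldsymbol a;(\boldsymbol b; c)$; (2) $\boldsymbol\pi; a = a$; (3) $\langle \mathsf A_1^n a\rangle; a = 0$ (i.e. $\langle \mathsf A_1^n a\rangle; a=\langle \mathsf A_1^n b\rangle; b$ for all $a,b$, so that $0$ is a well-defined constant); (4) $\langle a_1,\dots,a_{i-1},0,a_{i+1},\dots,a_n\rangle; b = 0$ for every $i$; (5) $\boldsymbol a; 0 = 0$; (6) $\boldsymbol a;\mathsf A_i b = \langle \mathsf A_1^n(\boldsymbol a; b)\rangle;\langle \mathsf D_1^n a_1\rangle;\cdots;\langle \mathsf D_1^n a_n\rangle; a_i$ for every $i$; (7) $\langle \mathsf D_1^n a\rangle; b=\langle \mathsf D_1^n a\rangle; c \ \wedge\ \langle \mathsf A_1^n a\rangle; b=\langle \mathsf A_1^n a\rangle; c \ \rightarrow\ b=c$; (8) $\langle \mathsf D_1^n a\rangle; a = a$; (9) $\mathsf A_i\mathsf A_j a=\mathsf A_i\mathsf A_k a$ for every $i,j,k$.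
   Context: Fix $n\ge 1$; indices $i,j,k$ range over $\{1,\dots,n\}$. The signature has an $(n+1)$-ary operation (composition), written $\langle a_1,\dots,a_n\rangle ; b$, and unary operations $\mathsf A_1,\dots,\mathsf A_n$. Algebras are nonempty. An $n$-ary partial function on a set $X$ is a set $f\subseteq X^{n+1}$ such that $(\boldsymbol x,y),(\boldsymbol x,z)\in f$ implies $y=z$ (where $\boldsymbol x\in X^n$). An algebra of $n$-ary partial functions of this signature is an algebra whose elements are $n$-ary partial functions, for which there are a set $X$ (the base) and an equivalence relation $E$ on $X$ such that every tuple $(x_1,\dots,x_{n+1})$ in every element lies in $X^{n+1}$ and has pairwise $E$-equivalent entries, and whose operations are $\boldsymbol f; g=\{(\boldsymbol x,z)\in X^{n+1} : \exists \boldsymbol y\in X^n,\ (\boldsymbol x,y_i)\in f_i \text{ for each } i \text{ and } (\boldsymbol y,z)\in g\}$, $\mathsf A_i(f)=\{(\boldsymbol x,x_i)\in X^{n+1} : x_1,\dots,x_n \text{ all } E\text{-equivalent and there is no } y\in X \text{ with } (\boldsymbol x,y)\in f\}$. An algebra is representable by $n$-ary partial functions if it is isomorphic to an algebra of $n$-ary partial functions of the same signature. A proper quasivariety is a quasivariety that is not a variety. Notation: a bold symbol $\boldsymbol a$ in a term $\boldsymbol a; b$ stands for $\langle a_1,\dots,a_n\rangle$; unbracketed compositions associate to the right ($\boldsymbol a;\boldsymbol b; c=\boldsymbol a;(\boldsymbol b; c)$); for unary operations $\mathsf B_1,\dots,\mathsf B_n$, $\langle \mathsf B_1^n a\rangle$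 means $\langle \mathsf B_1 a,\dots,\mathsf B_n a\rangle$. Abbreviations: $0:=\langle \mathsf A_1^n b\rangle; b$ for any $b$; $\pi_i:=\mathsf A_i 0$; $\boldsymbol\pi:=\langle\pi_1,\dots,\pi_n\rangle$; $\mathsf D_i a:=\mathsf A_i\mathsf A_i a$. *)

(* Defs.v *)
From Stdlib Require List.
From mathcomp Require Import all_boot.
From mathcomp Require Import classical_sets.

Set Implicit Arguments.
Unset Strict Implicit.
Unset Printing Implicit Defensive.

Local Open Scope classical_set_scope.

Declare Scope term_scope.
Delimit Scope term_scope with term.
Reserved Notation "a ;; b" (at level 60, right associativity).
Reserved Notation "s =~ t" (at level 70, no associativity).

(* Throughout, indices range over 'I_n = {0, ..., n-1} in place of {1, ..., n},
   and n-tuples of elements of X are functions 'I_n -> X. *)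

Record algebra (n : nat) := Algebra {
  carrier :> Type;
  compose : ('I_n -> carrier) -> carrier -> carrier;
  antidom : 'I_n -> carrier -> carrier;
  carrier_inhabited : inhabited carrier
}.

Definition is_hom n (A B : algebra n) (h : A -> B) : Prop :=
  (forall (a : 'I_n -> A) (b : A), h (compose a b) = compose (h \o a) (h b)) /\
  (forall (i : 'I_n) (a : A), h (antidom i a) = antidom i (h a)).

Definition isomorphic n (A B : algebra n) : Prop :=
  exists h : A -> B, bijective h /\ is_hom h.

(* The pair (x, y) stands for the (n+1)-tuple (x_1, ..., x_n, y). *)
Definition relation_on (n : nat) (X : Type) := set (('I_n -> X) * X).

Definition is_partial_function n X (f : relation_on n X) : Prop :=
  forall x y z, f (x, y) -> f (x, z) -> y = z.

Definition pairwise_equiv n X (E : X -> X -> Prop) (x : 'I_n -> X) : Prop :=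
  forall i j, E (x i) (x j).

Definition pf_compose n X (f : 'I_n -> relation_on n X)
    (g : relation_on n X) : relation_on n X :=
  [set xz | exists y : 'I_n -> X, (forall i, f i (xz.1, y i)) /\ g (y, xz.2)].

Definition pf_antidom n X (E : X -> X -> Prop) (i : 'I_n)
    (f : relation_on n X) : relation_on n X :=
  [set xz | [/\ xz.2 = xz.1 i, pairwise_equiv E xz.1
              & ~ exists y, f (xz.1, y)]].

Record pfun_algebra (n : nat) := PfunAlgebra {
  base : Type;
  base_equiv : base -> base -> Prop;
  equiv_equivalence : RelationClasses.Equivalence base_equiv;
  elements : set (relation_on n base);
  elements_nonempty : elements !=set0;
  elements_pfun : forall f, elements f -> is_partial_function f;
  elements_equiv : forall f, elements f -> forall x y, f (x, y) ->
    pairwise_equiv base_equiv x /\ forall i, base_equiv (x i) y;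
  elements_comp : forall f g, (forall i, elements (f i)) -> elements g ->
    elements (pf_compose f g);
  elements_antidom : forall i f, elements f ->
    elements (pf_antidom base_equiv i f)
}.

Section AlgebraOfPfunAlgebra.
Variables (n : nat) (P : pfun_algebra n).

Definition pfun_carrier : Type := {f : relation_on n (base P) | elements f}.

Definition pfun_compose (f : 'I_n -> pfun_carrier) (g : pfun_carrier) :
    pfun_carrier :=
  exist _ (pf_compose (fun i => sval (f i)) (sval g))
    (elements_comp (fun i => svalP (f i)) (svalP g)).

Definition pfun_antidom (i : 'I_n) (f : pfun_carrier) : pfun_carrier :=
  exist _ (pf_antidom (@base_equiv n P) i (sval f))
    (elements_antidom i (svalP f)).

Lemma pfun_carrier_inhabited : inhabited pfun_carrier.
Proof. by have [f Pf] := elements_nonempty P; split; exists f. Qed.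

Definition algebra_of_pfuns : algebra n :=
  Algebra pfun_compose pfun_antidom pfun_carrier_inhabited.
End AlgebraOfPfunAlgebra.

Definition representable n (A : algebra n) : Prop :=
  exists P : pfun_algebra n, isomorphic A (algebra_of_pfuns P).

Inductive term (n : nat) : Type :=
| Var of nat
| Comp of ('I_n -> term n) & term n
| Anti of 'I_n & term n.
Arguments Var {n}.

Bind Scope term_scope with term.
Notation "a ;; b" := (Comp a b) : term_scope.
Local Open Scope term_scope.

Fixpoint eval n (A : algebra n) (v : nat -> A) (t : term n) : A :=
  match t with
  | Var k => v k
  | Comp a b => compose (fun i => eval v (a i)) (eval v b)
  | Anti i a => antidom i (eval v a)
  end.

Record equation (n : nat) := Equation { lhs : term n; rhs : term n }.
Notation "s =~ t" := (Equation s t) : term_scope.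

Record quasiequation (n : nat) := Quasiequation {
  premises : seq (equation n);
  conclusion : equation n
}.

Definition holds_at n (A : algebra n) (v : nat -> A) (e : equation n) : Prop :=
  eval v (lhs e) = eval v (rhs e).

Definition sat_equation n (A : algebra n) (e : equation n) : Prop :=
  forall v : nat -> A, holds_at v e.

Definition sat_quasiequation n (A : algebra n) (q : quasiequation n) : Prop :=
  forall v : nat -> A,
    (forall e, List.In e (premises q) -> holds_at v e) ->
    holds_at v (conclusion q).

Definition axiomatised_by_equations n (K : algebra n -> Prop)
    (S : set (equation n)) : Prop :=
  forall A, K A <-> forall e, S e -> sat_equation A e.

Definition axiomatised_by_quasiequations n (K : algebra n -> Prop)
    (S : set (quasiequation n)) : Prop :=
  forall A, K A <-> forall q, S q -> sat_quasiequation A q.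

Definition variety n (K : algebra n -> Prop) : Prop :=
  exists S, axiomatised_by_equations K S.

Definition quasivariety n (K : algebra n -> Prop) : Prop :=
  exists S, axiomatised_by_quasiequations K S.

Definition proper_quasivariety n (K : algebra n -> Prop) : Prop :=
  quasivariety K /\ ~ variety K.

Definition finitely_axiomatised_by n (K : algebra n -> Prop)
    (L : seq (quasiequation n)) : Prop :=
  axiomatised_by_quasiequations K [set q | List.In q L].

Section TheQuasiequations.
Variable n : nat.
Implicit Types (a b c z : term n) (i j k : 'I_n).

Definition plain (e : equation n) : quasiequation n := Quasiequation [::] e.

Definition Dom i a := Anti i (Anti i a).

Definition Antis a : 'I_n -> term n := fun i => Anti i a.
Definition Doms a : 'I_n -> term n := fun i => Dom i a.

(* The constant 0 is an abbreviation depending on the choice of a term z; every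
   axiom mentioning 0 takes for z a variable not occurring elsewhere in it. *)
Definition zero z := Antis z ;; z.
Definition proj z : 'I_n -> term n := fun i => Anti i (zero z).

(* Tuples of variables a_1, ..., a_n and b_1, ..., b_n, and further variables;
   these are pairwise distinct. *)
Definition va : 'I_n -> term n := fun i => Var i.
Definition vb : 'I_n -> term n := fun i => Var (n + i).
Definition a0 : term n := Var (n + n).
Definition b0 : term n := Var (n + n).+1.
Definition c0 : term n := Var (n + n).+2.
Definition z0 : term n := Var (n + n).+3.

Definition ax1 := plain ((fun i => va ;; vb i) ;; c0 =~ va ;; vb ;; c0).

Definition ax2 := plain (proj z0 ;; a0 =~ a0).

Definition ax3 := plain (Antis a0 ;; a0 =~ Antis b0 ;; b0).

Definition ax4 i :=
  plain ((fun k => if k == i then zero z0 else va k) ;; b0 =~ zero z0).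

Definition ax5 := plain (va ;; zero z0 =~ zero z0).

Definition ax6 i :=
  plain (va ;; Anti i b0 =~
         Antis (va ;; b0) ;;
           foldr (fun k t => Doms (va k) ;; t) (va i) (enum 'I_n)).

Definition ax7 :=
  Quasiequation [:: Doms a0 ;; b0 =~ Doms a0 ;; c0;
                    Antis a0 ;; b0 =~ Antis a0 ;; c0]
                (b0 =~ c0).

Definition ax8 := plain (Doms a0 ;; a0 =~ a0).

Definition ax9 i j k := plain (Anti i (Anti j a0) =~ Anti i (Anti k a0)).

Definition axioms : seq (quasiequation n) :=
  [:: ax1; ax2; ax3] ++ [seq ax4 i | i <- enum 'I_n] ++ [:: ax5] ++
  [seq ax6 i | i <- enum 'I_n] ++ [:: ax7; ax8] ++
  [seq ax9 p.1.1 p.1.2 p.2 | p <- enum {: 'I_n * 'I_n * 'I_n}].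

End TheQuasiequations.

(* Main.v *)
Require Import Defs.
From mathcomp Require Import all_boot.
From Stdlib Require Import RelationClasses.
From mathcomp Require Import boolp classical_sets.

(** An algebra of partial functions satisfies the laws by inspection, because
    <A_1 f, ..., A_n f>; g is the restriction of g to the tuples outside the
    domain of f, and <D_1 f, ..., D_n f>; g its restriction to the domain of f
    (pfun_laws).

    Conversely, let A satisfy the laws.  For c in A write (test c) for left
    composition by <A_1 c, ..., A_n c>, which ought to mean restriction to the
    places where c is undefined.  The laws make these operators commuting
    idempotents (test_comm), and test c, test (A_i c) behave as complements:
    by the quasiequation, x is determined by its images under both
    (test_cases).  For a set F of elements, read as the assumption that all of
    its members are undefined, let x and y agree when finitely many tests from F
    identify them.  When F is an ultrafilter, in the sense that it decides each
    c, the elements that do not agree with 0 form, modulo agreement, one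
    equivalence class of the base.  An element x acts on it on the right, by
    sending the tuple of the classes of a_1, ..., a_n to the class of a; x,
    unless a; x agrees with 0.  This is Cayley's representation; composition is
    preserved by associativity (cayley_comp), and A_i because of the law that
    evaluates a; A_i x (agree_antidom_undef, agree_antidom_def and
    cayley_antidom).  It is faithful: if x and y differ, a set F maximal among
    those for which x and y do not agree decides each c, since otherwise x and
    y would agree after both test c and test (A_i c) (ultra_separation); and x
    is recovered, modulo agreement, from its value at the classes of the
    projections (cayley_inj).

    The class is not a variety because it is not closed under quotients.  Take
    two places, two further places called sinks, and a congruence that
    identifies functions differing only by an exchange of sinks, provided that
    the domain stays away from one of the two places.  Two functions sending
    the two places to different sinks are then identified when restricted to
    either place, but not altogether, so that the quasiequation fails in the
    quotient (representable_not_variety), whereas every equation passes to the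
    quotient. *)

Set Implicit Arguments.
Unset Strict Implicit.
Unset Printing Implicit Defensive.

Local Open Scope nat_scope.

(** * Homomorphisms and congruences *)

Definition satisfies n (A : algebra n) (L : seq (quasiequation n)) : Prop :=
  forall q, List.In q L -> sat_quasiequation A q.

Section Homomorphisms.
Variables (n : nat) (A B : algebra n) (h : A -> B).
Hypothesis homh : is_hom h.

Lemma eval_hom (v : nat -> A) t : h (eval v t) = eval (h \o v) t.
Proof.
have [hcomp hanti] := homh.
elim: t => [//|a IHa b IHb|i a IHa] /=; last by rewrite hanti IHa.
by rewrite hcomp IHb; congr (compose _ _); apply: funext => i; apply: IHa.
Qed.

Lemma sat_quasiequation_inj q :
  injective h -> sat_quasiequation B q -> sat_quasiequation A q.
Proof.
move=> injh satB v prem; apply: injh; rewrite !eval_hom.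
by apply: satB => e /prem; rewrite /holds_at -!eval_hom => ->.
Qed.

Lemma sat_equation_surj e :
  (forall b, exists a, h a = b) -> sat_equation A e -> sat_equation B e.
Proof.
move=> surjh satA v; have [w hw] := choice (fun k => surjh (v k)).
have -> : v = h \o w by apply: funext => k; rewrite /= hw.
by rewrite /holds_at -!eval_hom satA.
Qed.

End Homomorphisms.

Definition congruence n (A : algebra n) (R : A -> A -> Prop) : Prop :=
  [/\ Equivalence R,
      (forall a a' b b', (forall i, R (a i) (a' i)) -> R b b' ->
         R (compose a b) (compose a' b'))
    & (forall i a a', R a a' -> R (antidom i a) (antidom i a'))].

Lemma equiv_class_eq T (R : T -> T -> Prop) a b :
  Equivalence R -> R a b <-> R a = R b.
Proof.
case=> rR sR tR; split=> [Rab|->]; last exact: rR.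
by apply/predeqP => c; split; apply: tR => //; apply: sR.
Qed.

(** The elements of the quotient are the classes themselves, as predicates, so
    that extensionality turns related elements into equal classes. *)
Lemma quotient_algebra n (A : algebra n) (R : A -> A -> Prop) :
  congruence R ->
  exists (B : algebra n) (h : A -> B),
    [/\ is_hom h, forall b, exists a, h a = b
      & forall a a', R a a' <-> h a = h a'].
Proof.
move=> [eqR compR antiR]; have refR := @Equivalence_Reflexive _ _ eqR.
pose Q := {C : A -> Prop | exists a, C = R a}.
pose cls a : Q := exist _ (R a) (ex_intro _ a erefl).
have clsP a a' : R a a' <-> cls a = cls a'.
  rewrite (equiv_class_eq _ _ eqR); split=> [e|[]//]; exact: eq_exist.
have /choice[rep repK] : forall C : Q, exists a, cls a = C.
  by move=> [C [a eC]]; exists a; apply: eq_exist.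
have cls_rep a : R a (rep (cls a)) by apply/clsP; rewrite repK.
have inhQ : inhabited Q.
  by have [a] := carrier_inhabited A; split; exact: (cls a).
exists (Algebra (fun a b => cls (compose (rep \o a) (rep b)))
                (fun i a => cls (antidom i (rep a))) inhQ), cls; split => //.
- split=> [a b|i a]; apply/clsP; last exact: antiR.
  by apply: compR => [i|]; apply: cls_rep.
- by move=> b; exists (rep b).
Qed.

(** * The axioms as laws of an algebra *)

Section Laws.
Variables (n : nat) (A : algebra n).

Definition anti (c : A) : 'I_n -> A := fun i => antidom i c.
Definition dom (c : A) : 'I_n -> A := fun i => antidom i (antidom i c).
Definition null (z : A) : A := compose (anti z) z.

(** The axioms read in A itself, free of terms and valuations. *)
Record laws : Prop := Laws {
  comp_assoc : forall a b c,
    compose (fun i => compose a (b i)) c = compose a (compose b c) :> A;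
  comp_proj : forall z a, compose (anti (null z)) a = a;
  null_eq : forall a b, null a = null b;
  comp_null_arg : forall i a b z,
    compose (fun k => if k == i then null z else a k) b = null z;
  comp_null : forall a z, compose a (null z) = null z;
  comp_antidom : forall i a b,
    compose a (antidom i b) =
    compose (anti (compose a b))
      (foldr (fun k t => compose (dom (a k)) t) (a i) (enum 'I_n));
  cases_eq : forall a b c,
    compose (dom a) b = compose (dom a) c ->
    compose (anti a) b = compose (anti a) c -> b = c;
  comp_dom : forall a, compose (dom a) a = a;
  antidom2_eq : forall i j k a,
    antidom i (antidom j a) = antidom i (antidom k a) :> A
}.

Lemma eval_foldr (v : nat -> A) (a : 'I_n -> term n) t s :
  eval v (foldr (fun k t => Comp (Doms (a k)) t) t s) =
  foldr (fun k t => compose (dom (eval v (a k))) t) (eval v t) s.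
Proof. by elim: s => //= k s ->. Qed.

(** The variables of the axioms have different indices, and can therefore be
    given values independently. *)
Lemma valuation_exists (a b : 'I_n -> A) (w x y z : A) :
  exists v : nat -> A,
    [/\ (fun i : 'I_n => v i) = a, (fun i : 'I_n => v (n + i)) = b,
        v (n + n) = w, v (n + n).+1 = x &
        v (n + n).+2 = y /\ v (n + n).+3 = z].
Proof.
exists (fun k => if insub k is Some i then a i else
  if insub (k - n) is Some i then b i else nth w [:: w; x; y; z] (k - (n + n))).
have far k : insub (n + n + k) = None :> option 'I_n.
  by apply: insubF; rewrite ltnNge -addnA leq_addr.
have far' k : insub (n + n + k - n) = None :> option 'I_n.
  by apply: insubF; rewrite -addnA addKn ltnNge leq_addr.
have vE k : (if insub (n + n + k) is Some i then a i else
  if insub (n + n + k - n) is Some i then b i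
  else nth w [:: w; x; y; z] (n + n + k - (n + n))) = nth w [:: w; x; y; z] k.
  by rewrite far far' addKn.
split; last split.
- by apply: funext => i; rewrite valK.
- apply: funext => i; rewrite insubF; last by rewrite ltnNge leq_addr.
  by rewrite addKn valK.
- by have := vE 0; rewrite addn0.
- by have := vE 1; rewrite addn1.
- by have := vE 2; rewrite addn2.
- by have := vE 3; rewrite addn3.
Qed.

Lemma satisfies_cat (s t : seq (quasiequation n)) :
  satisfies A (s ++ t) <-> satisfies A s /\ satisfies A t.
Proof.
elim: s => [|q s IHs] /=; first by split=> [h|[]//]; split=> // q [].
split=> [h|[hs ht] r [<-|rst]].
- have [hs ht] := IHs.1 (fun p ps => h p (or_intror ps)).
  by split=> // p [<-|/hs//]; apply: h; left.
- by apply: hs; left.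
- by apply: (IHs.2 _ r rst); split=> // p ps; apply: hs; right.
Qed.

Lemma satisfies_cons q s :
  satisfies A (q :: s) <-> sat_quasiequation A q /\ satisfies A s.
Proof.
split=> [h|[hq hs] p [<-//|/hs//]].
by split=> [|p ps]; apply: h; [left|right].
Qed.

Lemma satisfies_map (T : finType) (f : T -> quasiequation n) :
  satisfies A [seq f i | i <- enum T] <-> forall i, sat_quasiequation A (f i).
Proof.
suff map_seq (s : seq T) :
    satisfies A [seq f i | i <- s] <->
    {in s, forall i, sat_quasiequation A (f i)}.
  by rewrite map_seq; split=> h i; [apply: h; rewrite mem_enum|].
elim: s => [|x s IHs]; first by split=> [_ i|_ q []].
rewrite /= satisfies_cons IHs; split=> [[hx hs] i|h].
  by rewrite inE => /predU1P[->|/hs].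
by split=> [|i si]; apply: h; rewrite inE ?eqxx ?si ?orbT.
Qed.

Lemma sat_plain e : sat_quasiequation A (plain e) <-> sat_equation A e.
Proof. by split=> h v; [exact: h|move=> _; exact: h]. Qed.

Lemma satisfies_axioms :
  satisfies A (axioms n) <->
  [/\ sat_quasiequation A (ax1 n), sat_quasiequation A (ax2 n),
      sat_quasiequation A (ax3 n), forall i : 'I_n, sat_quasiequation A (ax4 i)
    & [/\ sat_quasiequation A (ax5 n),
          forall i : 'I_n, sat_quasiequation A (ax6 i),
          sat_quasiequation A (ax7 n), sat_quasiequation A (ax8 n)
        & forall i j k : 'I_n, sat_quasiequation A (ax9 i j k)]].
Proof.
rewrite /axioms !(satisfies_cat, satisfies_cons, satisfies_map).
split=> [[[? [? [? _]]] [? [[? _] [? [[? [? _]] h9]]]]]|].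
  by do !split=> //; move=> i j k; exact: (h9 (i, j, k)).
by case=> ? ? ? ? [? ? ? ? ?]; do !split.
Qed.

Lemma axioms_laws : satisfies A (axioms n) <-> laws.
Proof.
rewrite satisfies_axioms; split.
- case=> h1 h2 h3 h4 [h5 h6 h7 h8 h9].
  have [w] := carrier_inhabited A.
  split.
  + move=> a b c.
    have [v [ea eb _ _ [ec _]]] :=
      valuation_exists a b w w c w.
    have := (sat_plain _).1 h1 v; rewrite /holds_at /=.
    by rewrite -ea -eb -ec.
  + move=> z a.
    have [v [_ _ ea _ [_ ez]]] :=
      valuation_exists (fun=> w) (fun=> w) a w w z.
    have := (sat_plain _).1 h2 v; rewrite /holds_at /= ea ez; exact.
  + move=> a b.
    have [v [_ _ ea eb _]] :=
      valuation_exists (fun=> w) (fun=> w) a b w w.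
    have := (sat_plain _).1 h3 v; rewrite /holds_at /= ea eb; exact.
  + move=> i a b z.
    have [v [ea _ _ eb [_ ez]]] := valuation_exists a (fun=> w) w b w z.
    have := (sat_plain _).1 (h4 i) v; rewrite /holds_at /= eb ez => e.
    apply: etrans e; congr (compose _ _); apply: funext => k; rewrite -ea.
    by case: eqP => //=; rewrite ez.
  + move=> a z.
    have [v [ea _ _ _ [_ ez]]] :=
      valuation_exists a (fun=> w) w w w z.
    have := (sat_plain _).1 h5 v; rewrite /holds_at /= ea ez; exact.
  + move=> i a b.
    have [v [ea _ _ eb _]] := valuation_exists a (fun=> w) w b w w.
    have := (sat_plain _).1 (h6 i) v; rewrite /holds_at /= eval_foldr.
    by rewrite -ea -eb.
  + move=> a b c e1 e2.
    have [v [_ _ ea eb [ec _]]] := valuation_exists (fun=> w) (fun=> w) a b c w.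
    rewrite -eb -ec; apply: h7 => e [<-|[<-|[]]];
    by rewrite /holds_at /= ea eb ec.
  + move=> a.
    have [v [_ _ ea _ _]] :=
      valuation_exists (fun=> w) (fun=> w) a w w w.
    have := (sat_plain _).1 h8 v; rewrite /holds_at /= ea; exact.
  + move=> i j k a.
    have [v [_ _ ea _ _]] :=
      valuation_exists (fun=> w) (fun=> w) a w w w.
    have := (sat_plain _).1 (h9 i j k) v; rewrite /holds_at /= ea; exact.
- case=> h1 h2 h3 h4 h5 h6 h7 h8 h9.
  split; last split; try by [apply/sat_plain=> v; apply: h1
    | apply/sat_plain=> v; apply: h2 | apply/sat_plain=> v; apply: h3
    | apply/sat_plain=> v; apply: h5 | apply/sat_plain=> v; apply: h8].
  + move=> i; apply/sat_plain=> v.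
    apply: etrans (h4 i (fun k : 'I_n => v k) (v (n + n).+1) (v (n + n).+3)).
    by congr (compose _ _); apply: funext => k /=; case: eqP.
  + move=> i; apply/sat_plain=> v; rewrite /holds_at /= eval_foldr; exact: h6.
  + move=> v prem; have e1 := prem _ (or_introl erefl).
    exact: h7 e1 (prem _ (or_intror (or_introl erefl))).
  + by move=> i j k; apply/sat_plain=> v; apply: h9.
Qed.

End Laws.

(** * Algebras of partial functions satisfy the laws *)

Section Soundness.
Variables (n : nat) (i0 : 'I_n) (P : pfun_algebra n).
Let A := algebra_of_pfuns P.
Let X := base P.
Implicit Types (f g h : A) (x y : 'I_n -> X) (z : X) (i : 'I_n).

Definition graph (f : A) (x : 'I_n -> X) (z : X) : Prop := sval f (x, z).

Lemma graph_inj f g : (forall x z, graph f x z <-> graph g x z) -> f = g.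
Proof.
case: f g => [f Pf] [g Pg] fg; apply: eq_exist; apply/predeqP => -[x z].
exact: fg.
Qed.

Lemma graph_fun f x z z' : graph f x z -> graph f x z' -> z = z'.
Proof. exact: (elements_pfun (svalP f)). Qed.

Lemma graph_equiv f x z : graph f x z -> pairwise_equiv (@base_equiv n P) x.
Proof. by case/(elements_equiv (svalP f)). Qed.

(** Every value is equivalent to the first argument, so that a tuple of values
    at a common argument lies in the domain of a projection. *)
Lemma graph_args_equiv (a : 'I_n -> A) x y :
  (forall i, graph (a i) x (y i)) -> pairwise_equiv (@base_equiv n P) y.
Proof.
move=> axy i j; have [_ symE trE] := equiv_equivalence P.
have eqy k : base_equiv (x i0) (y k).
  by have [_] := elements_equiv (svalP (a k)) (axy k); apply.
exact: trE (symE _ _ (eqy i)) (eqy j).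
Qed.

Lemma graph_anti f x y : (forall i, graph (anti f i) x (y i)) <->
  [/\ y = x, pairwise_equiv (@base_equiv n P) x & ~ exists z, graph f x z].
Proof.
split=> [fxy|[-> eqx nfx] i]; last by split.
have [_ ? ?] := fxy i0; split=> //.
by apply: funext => i; have [] := fxy i.
Qed.

(** Together with the next lemma, this turns the laws on the A_i into
    statements about domains. *)
Lemma graph_comp_anti f g x z : graph (compose (anti f) g) x z <->
  graph g x z /\ ~ exists z', graph f x z'.
Proof.
split=> [[y [/graph_anti[-> _ nfx] gxz]]|[gxz nfx]]; first by [].
exists x; split; last exact: gxz.
by apply/graph_anti; split=> //; apply: graph_equiv gxz.
Qed.

Lemma graph_comp_dom f g x z : graph (compose (dom f) g) x z <->
  graph g x z /\ exists z', graph f x z'.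
Proof.
split=> [[y [fxy gyz]]|[gxz fx]].
  have yE : y = x by apply: funext => i; have [] := fxy i.
  move: gyz; rewrite yE => gxz; split=> //; apply: contrapT => nfx.
  have [_ eqx nAx] := fxy i0; apply: nAx; exists (x i0).
  by split.
exists x; split; last exact: gxz.
move=> i; split=> //=; first exact: graph_equiv gxz.
by case=> w [_ _]; apply; exact: fx.
Qed.

Lemma graph_null f x z : ~ graph (null f) x z.
Proof. by move=> /graph_comp_anti[fxz]; apply; exists z. Qed.

Lemma graph_foldr_dom (a : 'I_n -> A) f s x z :
  graph (foldr (fun k t => compose (dom (a k)) t) f s) x z <->
  graph f x z /\ forall k, k \in s -> exists z', graph (a k) x z'.
Proof.
elim: s => [|k s IHs]; first by split=> [|[]].
rewrite -cat1s foldr_cat; set t := foldr _ f s in IHs *.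
rewrite (graph_comp_dom (a k) t) IHs; split=> [[[fxz hs] hk]|[fxz h]].
  by split=> // j; rewrite inE => /predU1P[->|/hs].
split; last by apply: h; rewrite inE eqxx.
by split=> // j js; apply: h; rewrite inE js orbT.
Qed.

Lemma pfun_laws : laws A.
Proof.
split.
- move=> a b c; apply: graph_inj => x z; split.
    (* the n evaluations of the tuple a at x agree, by functionality *)
    case=> y [/choice[w aw] cyz]; have wE i : w i = w i0.
      apply: funext => j; have [awi _] := aw i; have [aw0 _] := aw i0.
      exact: graph_fun (awi j) (aw0 j).
    exists (w i0); split; first by have [] := aw i0.
    by exists y; split=> // i; rewrite -(wE i); have [] := aw i.
  by case=> w [axw [y [bwy cyz]]]; exists y; split=> // i; exists w.
- move=> z a; apply: graph_inj => x w; rewrite graph_comp_anti.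
  by split=> [[]|axw] //; split=> // -[w' /graph_null].
- by move=> a b; apply: graph_inj => x w; split=> /graph_null.
- move=> i a b z; apply: graph_inj => x w; split=> [|/graph_null//].
  by case=> y [/(_ i)]; rewrite eqxx => /graph_null.
- move=> a z; apply: graph_inj => x w; split=> [|/graph_null//].
  by case=> y [_ /graph_null].
- move=> i a b; apply: graph_inj => x z.
  rewrite graph_comp_anti graph_foldr_dom.
  split=> [[y [axy [/= -> eqy nby]]]|[[aixz /(_ _ (mem_enum _ _)) ax] nabx]].
    split; first by split=> [|k _]; [exact: axy|exists (y k); exact: axy].
    case=> w [y' [axy' byw]]; apply: nby; exists w.
    have <- // : y' = y.
    by apply: funext => k; exact: graph_fun (axy' k) (axy k).
  have /choice[y axy] := ax; exists y; split; first exact: axy.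
  split=> /=; first exact: graph_fun aixz (axy i).
    exact: graph_args_equiv axy.
  by case=> w byw; apply: nabx; exists w, y.
- move=> a b c eqd eqa; apply: graph_inj => x z.
  have [ax|nax] := EM (exists z', graph a x z').
    have E g : graph g x z <-> graph (compose (dom a) g) x z.
      by rewrite graph_comp_dom; split=> [|[]].
    by rewrite E eqd -E.
  have E g : graph g x z <-> graph (compose (anti a) g) x z.
    by rewrite graph_comp_anti; split=> [|[]].
  by rewrite E eqa -E.
- move=> a; apply: graph_inj => x z; rewrite graph_comp_dom.
  by split=> [[]//|axz]; split=> //; exists z.
- move=> i j k a; apply: graph_inj => x z.
  suff E l : graph (antidom i (antidom l a)) x z <->
     [/\ z = x i, pairwise_equiv (@base_equiv n P) x & exists w, graph a x w].
    by rewrite !E.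
  split=> [[/= -> eqx nx]|[-> eqx ax]].
    split=> //; apply: contrapT => nax; apply: nx; exists (x l); split=> //.
  by split=> // -[w [_ _]]; apply; apply: ax.
Qed.

End Soundness.

Lemma representable_satisfies_axioms n (i0 : 'I_n) (A : algebra n) :
  representable A -> satisfies A (axioms n).
Proof.
move=> [P [h [bijh homh]]] q qax.
apply: sat_quasiequation_inj homh _ (bij_inj bijh) _.
by have /axioms_laws := pfun_laws i0 P; apply.
Qed.

(** * The calculus of tests *)

Section Tests.
Variables (n : nat) (i0 : 'I_n) (A : algebra n).
Hypothesis lawsA : laws A.
Variable z0 : A.
Let o : A := null z0.
Implicit Types (a b : 'I_n -> A) (c d e x y : A) (s t : seq A) (i k : 'I_n).

(** One of the A_i is enough to form complements, since A_i A_j c does not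
    depend on j; so test (neg c) restricts to the domain of c. *)
Definition neg c : A := antidom i0 c.
(** Meant as the restriction of x to the places where c is undefined. *)
Definition test c x : A := compose (anti c) x.
(** Meant as the restriction of x to the places where no member of s is
    defined: the lists stand for the finite meets of tests. *)
Definition act s x : A := foldr test x s.

Lemma anti_neg c : anti (neg c) = dom c.
Proof. by apply: funext => i; apply: (antidom2_eq lawsA). Qed.

Lemma test_self c : test c c = o.
Proof. exact: (null_eq lawsA). Qed.

Lemma test_neg_self c : test (neg c) c = c.
Proof. by rewrite /test anti_neg (comp_dom lawsA). Qed.

Lemma test_null x : test o x = x.
Proof. exact: (comp_proj lawsA). Qed.

Lemma comp_o a : compose a o = o.
Proof. exact: (comp_null lawsA). Qed.

Lemma comp_arg_o a x i : a i = o -> compose a x = o.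
Proof.
move=> aio; rewrite -[RHS](comp_null_arg lawsA i a x z0).
by congr (compose _ _); apply: funext => k; case: eqP => // ->.
Qed.

Lemma test_comp c a x :
  test c (compose a x) = compose (fun i => test c (a i)) x.
Proof. by rewrite /test -(comp_assoc lawsA). Qed.

Lemma test_o c : test c o = o.
Proof. exact: comp_o. Qed.

Lemma act_comp s a x : act s (compose a x) = compose (fun i => act s (a i)) x.
Proof. by elim: s => //= c s ->; rewrite test_comp. Qed.

Lemma act_o s : act s o = o.
Proof. by elim: s => //= c s ->; apply: comp_o. Qed.

Lemma act_cat s t x : act (s ++ t) x = act s (act t x).
Proof. exact: foldr_cat. Qed.

(** The law for a; A_i x in terms of tests: a; A_i x is a_i restricted to
    where a; x is undefined and all the a_k are defined. *)
Lemma comp_antidom_act i a x : compose a (antidom i x) =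
  test (compose a x) (act [seq neg (a k) | k <- enum 'I_n] (a i)).
Proof.
rewrite (comp_antidom lawsA) /test; congr (compose _ _).
by elim: (enum 'I_n) => //= k s ->; rewrite /test anti_neg.
Qed.

Lemma act_negs_antidom i c (r : seq 'I_n) :
  act [seq neg (antidom k c) | k <- r] (antidom i c) = antidom i c.
Proof.
elim: r => //= k r ->; rewrite -[RHS]test_neg_self /neg.
by rewrite (antidom2_eq lawsA i0 k i).
Qed.

(** The domain conditions of the general law hold by themselves here, as every
    A_k c has the same domain as A_i c. *)
Lemma test_antidom c i x : test c (antidom i x) = test (test c x) (antidom i c).
Proof. by rewrite {1}/test comp_antidom_act act_negs_antidom. Qed.

(** By test_antidom in each entry of the tuple <A_1 d, ..., A_n d>: on the
    domain of test c, to be outside d is to be outside test c d. *)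
Lemma test_test c d x : test c (test d x) = test (test c d) (test c x).
Proof.
rewrite [test d x]/test [test c x]/test !test_comp; congr (compose _ _).
by apply: funext => i; rewrite /anti test_antidom.
Qed.

Lemma test_idem c x : test c (test c x) = test c x.
Proof. by rewrite test_test test_self test_null. Qed.

Lemma test_neg_test c x : test (neg c) (test c x) = o.
Proof.
rewrite [test c x]/test test_comp; apply: (@comp_arg_o _ _ i0).
exact: test_self.
Qed.

Lemma test_cases c x y :
  test (neg c) x = test (neg c) y -> test c x = test c y -> x = y.
Proof. by rewrite /test anti_neg; apply: (cases_eq lawsA). Qed.

Lemma test_left_regular c d x :
  test c (test d (test c x)) = test c (test d x).
Proof. by rewrite !(test_test c d) test_idem. Qed.

(** The left regular band law c d c = c d, combined with a case distinction on
    c: off c both sides vanish, on c they are both c d x. *)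
Lemma test_comm c d x : test c (test d x) = test d (test c x).
Proof.
apply: (test_cases (c := c)); last by rewrite test_idem test_left_regular.
by rewrite -(test_left_regular (neg c) d) !test_neg_test !test_o.
Qed.

Lemma act_test s c x : act s (test c x) = test c (act s x).
Proof. by elim: s => //= d s ->; rewrite test_comm. Qed.

Lemma act_comm s t x : act s (act t x) = act t (act s x).
Proof. by elim: t => //= c t IHt; rewrite act_test IHt. Qed.

Lemma act_idem s x : act s (act s x) = act s x.
Proof. by elim: s => //= c s IHs; rewrite act_test IHs test_idem. Qed.

(** The identity test_antidom for finite meets of tests, with
    act s (antidom i o) in the role of the i-th entry of the meet. *)
Lemma act_antidom s i x :
  act s (antidom i x) = test (act s x) (act s (antidom i o)).
Proof.
elim: s => [|c s IHs] /=; first by rewrite test_antidom test_o test_null.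
by rewrite IHs test_test.
Qed.

(** If x vanishes on the meet of s, then this meet lies below the complement of
    the domain of x. *)
Lemma act_test_of_null s x y : act s x = o -> act s (test x y) = act s y.
Proof.
move=> sxo; rewrite -[in RHS](test_null y) /test !act_comp.
congr (compose _ _); apply: funext => i.
by rewrite /anti act_antidom sxo test_null.
Qed.

(** * Agreement relative to a set of tests *)


Definition agree (F : set A) x y : Prop :=
  exists2 s, all (mem F) s & act s x = act s y.

(** A contradictory F makes all elements agree with 0, and so contributes no
    points to the base. *)
Definition ultra (F : set A) : Prop := forall c, F c \/ F (neg c).

Section Agreement.
Variable F : set A.

Lemma agree_refl x : agree F x x.
Proof. by exists [::]. Qed.

Lemma agree_sym x y : agree F x y -> agree F y x.
Proof. by case=> s Fs e; exists s. Qed.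

Lemma agree_trans y x z : agree F x y -> agree F y z -> agree F x z.
Proof.
move=> [s Fs exy] [t Ft eyz]; exists (s ++ t); first by rewrite all_cat Fs.
by rewrite !act_cat -eyz !(act_comm s t) exy.
Qed.

Lemma agree_equivalence : Equivalence (agree F).
Proof.
split=> x; [exact: agree_refl|exact: agree_sym|].
by move=> y z; apply: agree_trans.
Qed.

Lemma agree_act s x : all (mem F) s -> agree F (act s x) x.
Proof. by exists s; rewrite ?act_idem. Qed.

Lemma agree_test c x : F c -> agree F (test c x) x.
Proof.
move=> Fc; apply: (@agree_act [:: c]).
by rewrite /= andbT; apply/mem_set.
Qed.

(** Finitely many agreements are witnessed by a single list of tests. *)
Lemma agree_comp a b x :
  (forall i, agree F (a i) (b i)) -> agree F (compose a x) (compose b x).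
Proof.
move=> ab; suff [s Fs sab] : exists2 s, all (mem F) s &
    {in enum 'I_n, forall i, act s (a i) = act s (b i)}.
  exists s => //; rewrite !act_comp; congr (compose _ _).
  by apply: funext => i; apply: sab; rewrite mem_enum.
elim: (enum 'I_n) => [|i r [s Fs sab]]; first by exists [::].
have [t Ft tab] := ab i; exists (s ++ t); first by rewrite all_cat Fs.
move=> k; rewrite inE !act_cat => /predU1P[->|/sab skab]; first by rewrite tab.
by rewrite !(act_comm s t) skab.
Qed.

Lemma agree_comp_arg_o a x i : agree F (a i) o -> agree F (compose a x) o.
Proof.
case=> s Fs sao; exists s => //; rewrite act_comp act_o.
by apply: (@comp_arg_o _ _ i); rewrite sao act_o.
Qed.

Lemma agree_o c x : F c -> agree F (test c x) o -> agree F x o.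
Proof. by move=> Fc; apply: agree_trans; apply/agree_sym/agree_test. Qed.

Hypothesis ultraF : ultra F.

Lemma ultra_neg c : ~ agree F c o -> F (neg c).
Proof.
move=> nco; have [Fc|//] := ultraF c; case: nco; apply: (agree_o Fc).
by rewrite test_self; apply: agree_refl.
Qed.

(** The two factors in comp_antidom_act are meets of tests that hold under F:
    the first because a; x vanishes there, the others because no a_k does. *)
Lemma agree_antidom_undef a x i :
  (forall k, ~ agree F (a k) o) -> agree F (compose a x) o ->
  agree F (compose a (antidom i x)) (a i).
Proof.
move=> nao [s Fs sao]; rewrite comp_antidom_act.
apply: (@agree_trans (act [seq neg (a k) | k <- enum 'I_n] (a i))).
  by exists s => //; apply: act_test_of_null; rewrite sao act_o.
apply: agree_act; rewrite all_map; apply/allP => k _.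
by apply/mem_set/ultra_neg/nao.
Qed.

(** Under F the element a; x is defined, and comp_antidom_act restricts to
    where it is undefined. *)
Lemma agree_antidom_def a x i :
  ~ agree F (compose a x) o -> agree F (compose a (antidom i x)) o.
Proof.
move=> /ultra_neg Fn; apply: (agree_o Fn).
by rewrite comp_antidom_act test_neg_test; apply: agree_refl.
Qed.

End Agreement.

(** An agreement involves finitely many tests, all in one member of the chain.
    The hypothesis on x and y excludes the empty list for the empty chain. *)
Lemma agree_bigcup_chain (C : set (set A)) x y : x <> y ->
  total_on C subset -> agree (\bigcup_(F in C) F)%classic x y ->
  exists2 F, C F & agree F x y.
Proof.
move=> xy Ctot [s Us e].
suff [s0|[F CF Fs]] : s = [::] \/ exists2 F, C F & all (mem F) s.
- by case: xy; move: e; rewrite s0.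
- by exists F => //; exists s.
elim: s Us {e} => [|c s IHs]; first by left.
case/andP=> /set_mem[G CG Gc] /IHs[->|[F CF Fs]]; right.
  by exists G => //=; rewrite andbT; apply/mem_set.
have [FG|GF] := Ctot _ _ CF CG.
  exists G => //=; apply/andP; split; first exact/mem_set.
  by apply: sub_all Fs => d /set_mem/FG/mem_set.
by exists F => //=; apply/andP; split=> //; apply/mem_set/GF.
Qed.

(** By commutativity all the occurrences of test c can be gathered in front. *)
Lemma agree_setU1 (F : set A) c x y : agree (c |` F)%classic x y ->
  agree F (test c x) (test c y).
Proof.
move=> [s cFs e].
suff [t Ft tE] : exists2 t, all (mem F) t &
    forall w, test c (act t w) = test c (act s w).
  by exists t; rewrite // !act_test !tE e.
elim: s cFs {e} => [|d s IHs] /=; first by exists [::].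
case/andP=> /set_mem[->|Fd] /IHs[t Ft tE].
  by exists t => // w; rewrite test_idem tE.
exists (d :: t); first by rewrite /= Ft andbT; apply/mem_set.
by move=> w /=; rewrite test_comm tE test_comm.
Qed.

Lemma agree_cases F c x y : agree F (test c x) (test c y) ->
  agree F (test (neg c) x) (test (neg c) y) -> agree F x y.
Proof.
move=> [s Fs es] [t Ft et]; exists (s ++ t); first by rewrite all_cat Fs.
rewrite !act_cat; apply: (@test_cases c).
  by rewrite -!act_test et.
by rewrite !(act_comm s t) -!act_test es.
Qed.

(** The prime ideal theorem for the tests: if a maximal F decided neither way
    on c, then x and y would agree under F on both sides of c. *)
Lemma ultra_separation x y : x <> y -> exists2 F, ultra F & ~ agree F x y.
Proof.
move=> xy; have [C Csub Ctot|F [nF maxF]] :=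
    @Zorn_bigcup A (fun F => ~ agree F x y).
  by move=> /(agree_bigcup_chain xy Ctot)[F /Csub].
exists F => // c.
have maxE d : ~ F d -> agree F (test d x) (test d y).
  move=> nFd; apply: agree_setU1; apply: contrapT; apply: maxF.
  by split=> [e Fe|dF]; [right|apply/nFd/dF; left].
have [|nFc] := EM (F c); [by left|right; apply: contrapT => nFn].
by apply: nF; apply: (@agree_cases _ c); apply: maxE.
Qed.

(** * The representation *)

(** A class is kept as a set together with its ultrafilter, so that points in
    different components can be compared without dependent types. *)
Record point := Point {
  filt : set A;
  pclass : set A;
  point_spec : exists x,
    [/\ ultra filt, ~ agree filt x o & pclass = agree filt x]
}.

Definition rep (p : point) : A := sval (cid (point_spec p)).

Lemma filt_ultra p : ultra (filt p).
Proof. by have [x []] := point_spec p. Qed.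

Lemma rep_nonzero p : ~ agree (filt p) (rep p) o.
Proof. by rewrite /rep; case: cid => x []. Qed.

Lemma pclass_rep p : pclass p = agree (filt p) (rep p).
Proof. by rewrite /rep; case: cid => x []. Qed.

Lemma point_eq p q : filt p = filt q -> agree (filt q) (rep p) (rep q) -> p = q.
Proof.
move=> eF; rewrite (equiv_class_eq _ _ (agree_equivalence _)).
rewrite -{1}eF -!pclass_rep.
case: p q eF => [F C sp] [G D sq] /= eF eC.
by move: sp sq; rewrite eF eC => sp sq; congr Point; apply: Prop_irrelevance.
Qed.

Lemma point_exists F x : ultra F -> ~ agree F x o ->
  exists p, filt p = F /\ agree F (rep p) x.
Proof.
move=> uF nxo.
pose p := @Point F (agree F x) (ex_intro _ x (And3 uF nxo erefl)).
exists p; split=> //; apply/(equiv_class_eq _ _ (agree_equivalence F)).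
exact/esym/(pclass_rep p).
Qed.

Definition same_filt (p q : point) : Prop := filt p = filt q.

Lemma same_filt_equivalence : Equivalence same_filt.
Proof. by split=> [p|p q|p q r]; rewrite /same_filt // => ->. Qed.

(** The action of x by right composition: a point is a class of elements, and
    the tuple of classes of a is sent to the class of a; x. *)
Definition cayley (x : A) : relation_on n point :=
  [set pq | (forall i, filt (pq.1 i) = filt pq.2) /\
            agree (filt pq.2) (compose (rep \o pq.1) x) (rep pq.2)]%classic.

Lemma cayley_fun x : is_partial_function (cayley x).
Proof.
move=> p q r [/= eq aq] [/= er ar].
have eqr : filt q = filt r by rewrite -(eq i0) -(er i0).
apply: point_eq => //; apply: agree_trans ar; rewrite -eqr.
exact: agree_sym.
Qed.

Lemma cayley_equiv x (p : 'I_n -> point) q : cayley x (p, q) ->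
  pairwise_equiv same_filt p /\ forall i, same_filt (p i) q.
Proof.
move=> [/= pq _]; split=> [i j|i]; last exact: pq.
by rewrite /same_filt !pq.
Qed.

Lemma cayley_exists x (p : 'I_n -> point) F :
  (forall i, filt (p i) = F) -> ~ agree F (compose (rep \o p) x) o ->
  exists q, filt q = F /\ cayley x (p, q).
Proof.
move=> pF nxo; have uF : ultra F by rewrite -(pF i0); apply: filt_ultra.
have [q [qF aq]] := point_exists uF nxo.
by exists q; split=> //; split=> [i|] /=; rewrite qF //; apply: agree_sym.
Qed.

Lemma cayley_nonzero x (p : 'I_n -> point) q :
  cayley x (p, q) -> ~ agree (filt q) (compose (rep \o p) x) o.
Proof.
move=> [_ /= apq] pxo; apply: (@rep_nonzero q).
exact: agree_trans (agree_sym apq) pxo.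
Qed.

(** If a value of a; x is defined at p, then so is every a_i, since
    compositions with an argument agreeing with 0 agree with 0. *)
Lemma cayley_comp a x :
  pf_compose (fun i => cayley (a i)) (cayley x) = cayley (compose a x).
Proof.
apply/predeqP => -[p r]; split.
  case=> q [apq [/= qr aqr]]; split=> [i|] /=.
    by have [/= pq _] := apq i; rewrite pq qr.
  apply: agree_trans aqr; rewrite -(comp_assoc lawsA); apply: agree_comp => i.
  by have [_] := apq i; rewrite /= qr.
move=> pxr; have [/= pr apr] := pxr.
have nao i : ~ agree (filt r) (compose (rep \o p) (a i)) o.
  move=> ao; apply: (cayley_nonzero pxr) => /=; rewrite -(comp_assoc lawsA).
  exact: agree_comp_arg_o ao.
have /choice[q qP] : forall i, exists q, filt q = filt r /\ cayley (a i) (p, q).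
  by move=> i; apply: cayley_exists.
exists q; split=> [i|]; first by have [] := qP i.
split=> [i|] /=; first by have [] := qP i.
apply: agree_trans apr; rewrite -(comp_assoc lawsA); apply: agree_comp => i.
by have [qr [_ /=]] := qP i; rewrite qr; apply: agree_sym.
Qed.

Lemma cayley_antidom i x :
  pf_antidom same_filt i (cayley x) = cayley (antidom i x).
Proof.
apply/predeqP => -[p q].
have rep_nz F (pF : forall k, filt (p k) = F) k : ~ agree F ((rep \o p) k) o.
  by rewrite -(pF k); apply: rep_nonzero.
split.
- case=> /= -> pE nxp; have pF k : filt (p k) = filt (p i) by apply: pE.
  split=> //=; apply: agree_antidom_undef; [exact: filt_ultra|exact: rep_nz|].
  apply: contrapT => /(cayley_exists pF)[r [_ xpr]].
  by apply: nxp; exists r.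
- move=> Axpq; have [/= pF apq] := Axpq.
  have xpo : agree (filt q) (compose (rep \o p) x) o.
    apply: contrapT => /(agree_antidom_def (@filt_ultra q) i).
    exact: cayley_nonzero Axpq.
  split=> /=.
  + apply/esym/point_eq; first exact: pF.
    apply: agree_trans apq; apply: agree_sym.
    by apply: agree_antidom_undef => //; [exact: filt_ultra|exact: rep_nz].
  + by move=> j k; rewrite /same_filt !pF.
  + case=> r xpr; apply: (cayley_nonzero xpr) => /=.
    by have [/= pr _] := xpr; rewrite -(pr i0) pF.
Qed.

(** At the classes of the projections, x takes as its value its own class. *)
Lemma cayley_sep F x y : ultra F -> cayley x = cayley y -> ~ agree F x o ->
  agree F x y.
Proof.
move=> uF exy nxo.
have proj_nz i : ~ agree F (anti o i) o.
  by move=> po; apply: nxo; rewrite -(test_null x); apply: agree_comp_arg_o po.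
have /choice[p pP] :
    forall i, exists p, filt p = F /\ agree F (rep p) (anti o i).
  by move=> i; apply: point_exists.
have pF i : filt (p i) = F by have [] := pP i.
have px w : agree F (compose (rep \o p) w) w.
  rewrite -{2}(test_null w); apply: agree_comp => i.
  by have [] := pP i.
have [|q [qF xpq]] := @cayley_exists x _ _ pF.
  by move/(agree_trans (agree_sym (px x))).
have : cayley y (p, q) by rewrite -exy.
case: xpq => _ /= xq [_ /= yq]; rewrite qF in xq yq.
apply: agree_trans (agree_sym (px x)) (agree_trans _ (px y)).
exact: agree_trans xq (agree_sym yq).
Qed.

Lemma cayley_inj : injective cayley.
Proof.
move=> x y exy; apply: contrapT => /ultra_separation[F uF]; apply.
have [xo|] := EM (agree F x o); last exact: cayley_sep.
have [yo|nyo] := EM (agree F y o); first exact: agree_trans xo (agree_sym yo).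
exact/agree_sym/cayley_sep.
Qed.

Definition cayley_elements : set (relation_on n point) :=
  [set f | exists x, cayley x = f]%classic.

Lemma cayley_elements_comp f g :
  (forall i, cayley_elements (f i)) -> cayley_elements g ->
  cayley_elements (pf_compose f g).
Proof.
move=> /choice[a af] [x <-]; exists (compose a x); rewrite -cayley_comp.
by congr pf_compose; apply: funext.
Qed.

Lemma cayley_elements_antidom i f :
  cayley_elements f -> cayley_elements (pf_antidom same_filt i f).
Proof. by case=> x <-; exists (antidom i x); rewrite cayley_antidom. Qed.

Lemma laws_representable : representable A.
Proof.
pose P := @PfunAlgebra n point same_filt same_filt_equivalence cayley_elements
  (ex_intro _ _ (ex_intro _ z0 erefl))
  (fun f Pf => let: ex_intro x e := Pf in eq_ind _ _ (@cayley_fun x) _ e)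
  (fun f Pf => let: ex_intro x e := Pf in
     eq_ind _ (fun f => forall p q, f (p, q) -> _) (@cayley_equiv x) _ e)
  cayley_elements_comp cayley_elements_antidom.
pose h x : algebra_of_pfuns P := exist _ (cayley x) (ex_intro _ x erefl).
exists P, h; split; last split=> [a x|i x].
- have /choice[g gP] :
      forall f : algebra_of_pfuns P, exists x, cayley x = sval f.
    by move=> f; have := svalP f.
  exists g => [x|[f Pf]]; first by apply: cayley_inj; rewrite gP.
  by apply: eq_exist; rewrite gP.
- by apply: eq_exist; rewrite -cayley_comp.
- by apply: eq_exist; rewrite -cayley_antidom.
Qed.

End Tests.

(** * The representable algebras are not closed under quotients *)

Section NotVariety.
Variables (n : nat) (i0 : 'I_n).

(** The sinks are (true, _), and (false, c) is the place labelled c. *)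
Definition place : Type := (bool * bool)%type.
Implicit Types (p q r : place) (x y : 'I_n -> place).
Implicit Types f g h : relation_on n place.

Definition like p q : Prop := p = q \/ p.1 && q.1.
(** The sinks and the place labelled c.  Tame functions map tuples in one side
    to the same side, so that preimages of small functions are small. *)
Definition side (c : bool) p : bool := p.1 || (p.2 == c).

Lemma like_refl p : like p p.
Proof. by left. Qed.

Lemma like_sym p q : like p q -> like q p.
Proof. by case=> [->|]; [left|rewrite andbC; right]. Qed.

Lemma like_trans q p r : like p q -> like q r -> like p r.
Proof.
by case=> [->//|/andP[p1 q1]] [<-|/andP[_ r1]]; right; rewrite p1 ?q1 ?r1.
Qed.

(** Equality up to exchange of sinks, in the arguments and in the values, in
    the form of a simulation; it relates f to itself when f is compatible with
    identifying the sinks. *)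
Definition sim f g : Prop := forall x x' p, (forall i, like (x i) (x' i)) ->
  f (x, p) -> exists2 p', g (x', p') & like p p'.

Definition meets (c : bool) f : Prop :=
  exists x p, f (x, p) /\ forall i, side c (x i).

(** The domain avoids the tuples in one of the two sides.  In contrast to the
    functions themselves, small domains do not add up: the union of two small
    domains can meet both sides. *)
Definition small f : Prop := exists c, ~ meets c f.

Definition tame f : Prop := [/\ is_partial_function f, sim f f &
  forall c x p, f (x, p) -> (forall i, side c (x i)) -> side c p].

Lemma sim_trans g f h : sim f g -> sim g h -> sim f h.
Proof.
move=> fg gh x x' p xx' /fg-/(_ x (fun i => like_refl (x i)))[q gxq pq].
by have [r hxr qr] := gh _ _ _ xx' gxq; exists r => //; apply: like_trans qr.
Qed.

Lemma sim_comp (a b : 'I_n -> relation_on n place) f g :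
  (forall i, sim (a i) (b i)) -> sim f g ->
  sim (pf_compose a f) (pf_compose b g).
Proof.
move=> ab fg x x' p xx' [y [/= axy fyp]].
have /choice[y' yP] : forall i, exists q, b i (x', q) /\ like (y i) q.
  by move=> i; have [q bq yq] := ab i _ _ _ xx' (axy i); exists q.
have [p' gp' pp'] := fg _ _ _ (fun i => (yP i).2) fyp.
by exists p' => //; exists y'; split=> // i; case: (yP i).
Qed.

Let total (p q : place) : Prop := True.

Lemma sim_antidom i f g : sim g f ->
  sim (pf_antidom total i f) (pf_antidom total i g).
Proof.
move=> gf x x' p xx' [/= -> _ nfx]; exists (x' i) => //; split=> //=.
case=> q gxq; apply: nfx.
by have [r fxr _] := gf _ _ _ (fun j => like_sym (xx' j)) gxq; exists r.
Qed.

Lemma tame_comp (a : 'I_n -> relation_on n place) f :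
  (forall i, tame (a i)) -> tame f -> tame (pf_compose a f).
Proof.
move=> ta [ffun fsim fside]; split.
- move=> x p q [y [/= axy fyp]] [y' [/= axy' fyq]].
  suff yy' : y = y' by apply: ffun fyp _; rewrite yy'.
  by apply: funext => i; have [afun _ _] := ta i; apply: afun (axy i) (axy' i).
- by apply: sim_comp => // i; have [] := ta i.
- move=> c x p [y [/= axy fyp]] xc; apply: fside fyp _ => i.
  by have [_ _ aside] := ta i; apply: aside (axy i) xc.
Qed.

Lemma tame_antidom i f : tame f -> tame (pf_antidom total i f).
Proof.
move=> [ffun fsim fside]; split; last by move=> c x p [/= ->].
- by move=> x p q [/= -> _ _] [/= ->].
- exact: sim_antidom.
Qed.

(** For the full set C these functions differ in the sink they reach and have a
    large domain; for a singleton C they are the restrictions to one place, and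
    are small. *)
Definition drop (C : set bool) (b : bool) : relation_on n place :=
  [set xp | (exists2 c, C c & xp.1 = (fun=> (false, c))) /\
            xp.2 = (true, b)]%classic.

Lemma sim_drop C b b' : sim (drop C b) (drop C b').
Proof.
move=> x x' p xx' [/= [c Cc ex] ->]; exists (true, b'); last by right.
split=> //=; exists c => //; apply: funext => i.
by have [|] := xx' i; rewrite ex // => <-.
Qed.

Lemma tame_drop C b : tame (drop C b).
Proof.
split; last by move=> c x p [/= _ ->].
- by move=> x p q [/= _ ->] [/= _ ->].
- exact: sim_drop.
Qed.

Definition tame_algebra : pfun_algebra n := @PfunAlgebra n place total
  ltac:(by split) [set f | tame f]%classic (ex_intro _ _ (tame_drop set0 true))
  (fun f tf => let: And3 ffun _ _ := tf in ffun)
  (fun f _ x p _ => conj (fun i j => I) (fun i => I))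
  tame_comp tame_antidom.

Let T := algebra_of_pfuns tame_algebra.

Lemma tameP (f : T) : tame (sval f).
Proof. exact: svalP f. Qed.

Definition confused (f g : T) : Prop :=
  f = g \/ [/\ sim (sval f) (sval g), sim (sval g) (sval f) & small (sval f)].

Lemma small_sim f g : sim g f -> small f -> small g.
Proof.
move=> gf [c nfc]; exists c => -[x [p [gxp xc]]]; apply: nfc.
by have [q fxq _] := gf _ x _ (fun i => like_refl (x i)) gxp; exists x, q.
Qed.

(** A composition has a smaller domain than its arguments, and the arguments
    map each side to itself. *)
Lemma small_comp (a : 'I_n -> relation_on n place) f :
  (forall i, tame (a i)) -> small f \/ (exists i, small (a i)) ->
  small (pf_compose a f).
Proof.
move=> ta [[c nc]|[i [c nc]]]; exists c => -[x [p [[y [/= axy fyp]] xc]]];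
  apply: nc; last by exists x, (y i).
by exists y, p; split=> // i; have [_ _ aside] := ta i; apply: aside (axy i) xc.
Qed.

Lemma confused_congruence : congruence confused.
Proof.
split.
- split=> [f|f g|f g h]; first by left.
    by case=> [->|[fg gf sf]]; [left|right; split=> //; exact: small_sim sf].
  case=> [->//|[fg gf sf]] [<-|[gh hg sg]]; right; first by [].
  by split=> //; [exact: sim_trans gh|exact: sim_trans gf].
- move=> a a' f f' aa' ff'.
  have simR (g g' : T) : confused g g' ->
      sim (sval g) (sval g') /\ sim (sval g') (sval g).
    by case=> [->|[]//]; have [] := tameP g'.
  have sim_aa' i := simR _ _ (aa' i).
  have sim_ff' := simR _ _ ff'.
  suff small_or : (a = a' /\ f = f') \/
      (small (sval f) \/ exists i, small (sval (a i))).
    have [[-> ->]|sm] := small_or; first by left.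
    right; split.
    + by apply: sim_comp => [i|]; [case: (sim_aa' i)|case: sim_ff'].
    + by apply: sim_comp => [i|]; [case: (sim_aa' i)|case: sim_ff'].
    + by apply: small_comp => // i; apply: tameP.
  have [|nsm] := EM (exists i, small (sval (a i))); first by right; right.
  case: ff' => [<-|[_ _ sf]]; last by right; left.
  left; split=> //; apply: funext => i.
  by case: (aa' i) => // -[_ _ si]; case: nsm; exists i.
- move=> i f g [->|[fg gf _]]; left=> //; apply: eq_exist.
  apply/predeqP => -[x p]; have refx j := like_refl (x j).
  split=> -[/= -> _ nx]; split=> //=; case=> q.
    by move/gf => /(_ x refx)[r fr _]; apply: nx; exists r.
  by move/fg => /(_ x refx)[r gr _]; apply: nx; exists r.
Qed.

Definition drop_elt C b : T := exist _ (drop C b) (tame_drop C b).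

Lemma dropP C b c p : C c -> drop C b ((fun=> (false, c)), p) <-> p = (true, b).
Proof. by move=> Cc; split=> [[]//|->]; split=> //; exists c. Qed.

(** On all of the diagonal tuples off the sinks the domain meets both sides, and
    so the two functions would have to be equal. *)
Lemma drop_not_confused : ~ confused (drop_elt setT true) (drop_elt setT false).
Proof.
case=> [/(congr1 sval) /= e|[_ _ [c []]]].
  have : drop setT true ((fun=> (false, true)), (true, true)) by exact/dropP.
  by rewrite e => -[].
exists (fun=> (false, c)), (true, true); split; first exact/dropP.
by move=> i; rewrite /side /= eqxx.
Qed.

Lemma comp_dom_drop b :
  compose (dom (drop_elt [set true] true)) (drop_elt setT b) =
  drop_elt [set true] b.
Proof.
apply: graph_inj => x p; rewrite (graph_comp_dom i0) /graph /=; split.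
  by move=> [[_ /= ->] [q [xt _]]].
move=> [[c -> /= xc] /= ->]; split; first by split=> //; exists true.
by exists (true, true); split=> //; exists true.
Qed.

Lemma comp_anti_drop b :
  compose (anti (drop_elt [set true] true)) (drop_elt setT b) =
  drop_elt [set false] b.
Proof.
apply: graph_inj => x p; rewrite (graph_comp_anti i0) /graph /=; split.
  move=> [[[[] _ /= xc] /= ->] nx]; last by split=> //; exists false.
  by case: nx; exists (true, true); split=> //; exists true.
move=> [[c -> /= xc] /= ->]; split; first by split=> //; exists false.
by case=> q [[d -> /= xd] _]; have := congr1 (@^~ i0) (etrans (esym xc) xd).
Qed.

Lemma confused_drop1 c :
  confused (drop_elt [set c] true) (drop_elt [set c] false).
Proof.
right; split; [exact: sim_drop|exact: sim_drop|].
exists (~~ c) => -[x [p [[[d /= -> ->] _] /(_ i0)]]].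
by rewrite /side /=; case: c.
Qed.

Lemma representable_not_variety : ~ variety (@representable n).
Proof.
move=> [S Sax].
have [B [h [homh surjh hP]]] := quotient_algebra confused_congruence.
have repB : representable B.
  apply/Sax => e Se; apply: sat_equation_surj homh _ surjh _.
  have /Sax : representable T; last by apply.
  by exists tame_algebra, id; split=> //; exists id.
have /axioms_laws lawsB := representable_satisfies_axioms i0 repB.
have [hcomp hanti] := homh.
have h_dom (f g : T) : compose (dom (h f)) (h g) = h (compose (dom f) g).
  by rewrite hcomp; congr compose; apply: funext => i /=; rewrite /dom !hanti.
have h_anti (f g : T) : compose (anti (h f)) (h g) = h (compose (anti f) g).
  by rewrite hcomp; congr compose; apply: funext => i /=; rewrite /anti !hanti.
apply: drop_not_confused; apply/hP.
apply: (cases_eq lawsB (a := h (drop_elt [set true] true))).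
  rewrite !h_dom !comp_dom_drop; exact/hP/confused_drop1.
rewrite !h_anti !comp_anti_drop; exact/hP/confused_drop1.
Qed.

End NotVariety.

Theorem theorem4p5 (n : nat) (n_ge1 : (1 <= n)%N) :
  proper_quasivariety (@representable n) /\
  finitely_axiomatised_by (@representable n) (axioms n).
Proof.
pose i0 := Ordinal n_ge1.
have ax : finitely_axiomatised_by (@representable n) (axioms n).
  move=> A; split=> [repA|satA].
    exact: representable_satisfies_axioms i0 A repA.
  have [z] := carrier_inhabited A.
  by apply: (laws_representable i0 _ z); apply/axioms_laws.
split=> //; split; last exact: representable_not_variety i0.
by exists [set q | List.In q (axioms n)]%classic.
Qed.
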